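(* Let $(\mathcal{B},\{P_t\}_{t\ge0},\mathbf{P},\{\vartheta_t\}_{t\ge0})$ be a stationary noise process, $\mathcal{X}$ a Polish space and $\varphi:\mathbb{R}^+\times\mathcal{X}\times\mathcal{B}\to\mathcal{X}$ a continuous stochastic dynamical system. Consider the probability space $(\Omega,\mathcal{F},\mathbb{P})$ with $\Omega:=\mathcal{B}\times\mathcal{B}$, $\mathcal{F}:=\sigma(\mathcal{B})\otimes\sigma(\mathcal{B})$, $\mathbb{P}:=\mathbf{P}\times\mathbf{P}$, and define $$\Phi:\mathbb{R}^+\times\mathcal{X}\times\Omega\to\mathcal{X},\qquad \Phi^t_{(\omega^-,\omega^+)}(x):=\varphi^t_{P_t(\omega^-,\omega^+)}(x),$$ and the shift $\theta_t:\Omega\to\Omega$, $t\in\mathbb{R}$, by $$\theta_t(\omega^-,\omega^+):=\begin{cases}(P_t(\omega^-,\omega^+),\vartheta_t\omega^+), & t\ge0,\\ (\vartheta_{-t}\omega^-,P_{-t}(\omega^+,\omega^-)), & t<0.\end{cases}$$ Then $\theta_{t+s}=\theta_t\circ\theta_s$ for all $t,s\in\mathbb{R}$, and $(\theta_t)_\star(\mathbf{P}\times\mathbf{P})=\mathbf{P}\times\mathbf{P}$ for all $t\in\mathbb{R}$. In conclusion, $\Phi$ is a continuous random dynamical system satisfying the cocycle property: for all $t,s\ge0$, $x\in\mathcal{X}$ and $(\omega^-,\omega^+)\in\Omega$, $$\Phi^{t+s}_{(\omega^-,\omega^+)}(x)=\Phi^s_{\theta_t(\omega^-,\omega^+)}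\circ\Phi^t_{(\omega^-,\omega^+)}(x).$$
   Context: $\sigma(\cdot)$ denotes the Borel $\sigma$-algebra, $\star$ the pushforward of measures. **Stationary noise process.** $(\mathcal{B},\{P_t\}_{t\ge0},\mathbf{P},\{\vartheta_t\}_{t\ge0})$, with $\mathcal{B}$ Polish, is a stationary noise process if: (I) $\mathbf{P}$ is a probability measure on $(\mathcal{B},\sigma(\mathcal{B}))$. (II) For every $t\ge0$, $P_t:\mathcal{B}\times\mathcal{B}\to\mathcal{B}$ and $\vartheta_t:\mathcal{B}\to\mathcal{B}$ are measurable, and for every $\omega^-\in\mathcal{B}$ the random variables $\omega^+\mapsto P_t(\omega^-,\omega^+)$ and $\omega^+\mapsto\vartheta_t(\omega^+)$ are independent under $\mathbf{P}$. (III) $\vartheta_{t+s}=\vartheta_t\circ\vartheta_s$ for $t,s\ge0$, and $(\vartheta_t)_\star\mathbf{P}=\mathbf{P}$. (IV) The kernels $\mathcal{P}_t(\omega^-;\cdot):=(P_t(\omega^-,\cdot))_\star\mathbf{P}$ form a Feller transition semigroup on $\mathcal{B}$: $\omega^-\mapsto\mathcal{P}_t(\omega^-;A)$ is measurable, $\mathcal{P}_{t+s}(\omega^-;A)=\int_{\mathcal{B}}\mathcal{P}_t(\omega^+;A)\mathcal{P}_s(\omega^-;\mathrm{d}\omega^+)$, $\mathcal{P}_0(\omega^-;A)=\chi_A(\omega^-)$, and $\mathcal{P}_tf(\omega^-)=\int f(P_t(\omega^-,\omega^+))\mathbf{P}(\mathrm{d}\omega^+)$ maps $C_b(\mathcal{B})$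 to $C_b(\mathcal{B})$; moreover $\mathbf{P}$ is its unique invariant measure. (V) For all $\omega^-,\omega^+\in\mathcal{B}$ and $t,s\ge0$: $\vartheta_t\circ P_t(\omega^-,\omega^+)=P_t(\vartheta_t\omega^-,P_t(\omega^+,\omega^-))=\omega^-$ and $P_{t+s}(\omega^-,\omega^+)=P_t(P_s(\omega^-,\omega^+),\vartheta_s\omega^+)$. **Continuous stochastic dynamical system (SDS).** A map $\varphi:\mathbb{R}^+\times\mathcal{X}\times\mathcal{B}\to\mathcal{X}$, $(t,x,\omega)\mapsto\varphi^t_\omega(x)$, such that: for every $T>0$, $\tilde\varphi_T(x,\omega)(t):=\varphi^t_{\vartheta_{T-t}\omega}(x)$, $t\in[0,T]$, belongs to $C([0,T],\mathcal{X})$ and $(x,\omega)\mapsto\tilde\varphi_T(x,\omega)$ is continuous from $\mathcal{X}\times\mathcal{B}$ to $C([0,T],\mathcal{X})$; and $\varphi^0_\omega(x)=x$, $\varphi^{t+s}_\omega(x)=\varphi^s_\omega\circ\varphi^t_{\vartheta_s\omega}(x)$ for all $t,s\ge0$. **Continuous random dynamical system (RDS).** A measurable metric dynamical system $(\Omega,\mathcal{F},\mathbb{P},\theta)$ (a probability space with maps $\theta_t:\Omega\to\Omega$, $(\omega,t)\mapsto\theta_t\omega$ measurable, $\theta_0=\mathrm{Id}$, $\theta_{s+t}=\theta_s\circ\theta_t$, $(\theta_t)_\star\mathbb{P}=\mathbb{P}$) together with a measurable $\Phi:\mathbb{R}^+\times\mathcal{X}\times\Omega\to\mathcal{X}$ with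 $\Phi^0_\omega=\mathrm{Id}_{\mathcal{X}}$, $\Phi^{t+s}_\omega=\Phi^s_{\theta_t\omega}\circ\Phi^t_\omega$ for $s,t\geq 0$, and $(t,x)\mapsto\Phi^t_\omega(x)$ continuous for every $\omega$.
   Formalization: That Φ is a continuous RDS in full is proved assuming (t,ω) ↦ ϑ_tω is jointly measurable on R⁺×B, which the axioms do not imply and the RDS definition requires; all other claims, including measurability, continuity and the cocycle property of Φ, are unconditional. *)

(* Defs.v *)
From HB Require Import structures.
From mathcomp Require Import all_boot all_order all_algebra.
From mathcomp Require Import all_classical all_reals all_analysis.
From mathcomp Require Import measurable_realfun.

Set Implicit Arguments.
Unset Strict Implicit.
Unset Printing Implicit Defensive.

Import Order.TTheory GRing.Theory Num.Theory.
Import numFieldNormedType.Exports.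

Local Open Scope classical_set_scope.
Local Open Scope ring_scope.

(* A Polish space, presented with a complete metric inducing its topology.
   Pointedness is part of the library's Complete structure. *)
HB.mixin Record Topological_isSeparable T & Topological T := {
  separable_subproof : exists2 D : set T, countable D & dense D
}.

#[short(type="polishType")]
HB.structure Definition Polish (R : numDomainType) :=
  {T of Complete T & Metric R T & Topological_isSeparable T}.

Notation borel T := (g_sigma_algebraType (@open T)).

Section measure_theoretic_notions.
Context {R : realType}.

Definition measure_preserving d (T : measurableType d) (P : set T -> \bar R)
    (f : T -> T) : Prop :=
  measurable_fun setT f /\
  forall A, measurable A -> pushforward P f A = P A.

Definition independent_rv d d1 d2 (T : measurableType d)
    (T1 : measurableType d1) (T2 : measurableType d2)
    (P : set T -> \bar R) (f : T -> T1) (g : T -> T2) : Prop :=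
  forall A B, measurable A -> measurable B ->
  (P (f @^-1` A `&` g @^-1` B) = P (f @^-1` A) * P (g @^-1` B))%E.

End measure_theoretic_notions.

(* Throughout, time is a real number; a family indexed by R^+ is represented by
   a function on R whose values at negative times are irrelevant. *)

Section stationary_noise_process.
Context {R : realType} {B : polishType R}.
Variables (P : R -> B -> B -> B) (PP : probability (borel B) R).
Variable shift : R -> B -> B.

Definition noise_kernel (t : R) (w : B) : set (borel B) -> \bar R :=
  pushforward PP (P t w : borel B -> borel B).

Definition invariant_measure (Q : set (borel B) -> \bar R) : Prop :=
  forall t : R, 0 <= t -> forall A : set (borel B), measurable A ->
  (\int[Q]_w noise_kernel t w A)%E = Q A.

Record feller_semigroup : Prop := {
  kernel_measurable : forall t : R, 0 <= t ->
    forall A : set (borel B), measurable A ->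
    measurable_fun [set: borel B] (fun w => noise_kernel t w A) ;
  kernel_chapman_kolmogorov : forall t s : R, 0 <= t -> 0 <= s ->
    forall w (A : set (borel B)), measurable A ->
    noise_kernel (t + s) w A =
      (\int[noise_kernel s w]_w' noise_kernel t w' A)%E ;
  kernel0 : forall w (A : set (borel B)), measurable A ->
    noise_kernel 0 w A = (\1_A w)%:E ;
  kernel_feller : forall t : R, 0 <= t ->
    forall f : B -> R, continuous f -> bounded_fun f ->
    let Ptf w := \int[PP]_w' f (P t w w') in
    continuous (Ptf : B -> R) /\ bounded_fun Ptf
}.

Record stationary_noise_process : Prop := {
  noise_measurable : forall t : R, 0 <= t ->
    measurable_fun [set: borel B * borel B]
      (fun w => P t w.1 w.2 : borel B) ;
  shift_measurable : forall t : R, 0 <= t ->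
    measurable_fun [set: borel B] (shift t : borel B -> borel B) ;
  noise_shift_independent : forall t : R, 0 <= t -> forall w,
    independent_rv PP (P t w : borel B -> borel B)
                      (shift t : borel B -> borel B) ;
  shiftD : forall t s : R, 0 <= t -> 0 <= s -> shift (t + s) = shift t \o shift s ;
  shift_preserving : forall t : R, 0 <= t ->
    measure_preserving PP (shift t : borel B -> borel B) ;
  noise_feller : feller_semigroup ;
  noise_invariant : invariant_measure PP ;
  noise_invariant_unique : forall Q : probability (borel B) R,
    invariant_measure Q ->
    forall A : set (borel B), measurable A -> Q A = PP A ;
  shift_noiseK : forall t : R, 0 <= t -> forall w1 w2, shift t (P t w1 w2) = w1 ;
  noise_shiftK : forall t : R, 0 <= t -> forall w1 w2,
    P t (shift t w1) (P t w2 w1) = w1 ;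
  noiseD : forall t s : R, 0 <= t -> 0 <= s -> forall w1 w2,
    P (t + s) w1 w2 = P t (P s w1 w2) (shift s w2)
}.

(* Joint measurability in (time, noise) of the one-sided shift; the axioms of a
   stationary noise process only give measurability at each fixed time. *)
Definition jointly_measurable_shift : Prop :=
  measurable_fun [set z : R * borel B | 0 <= z.1]
    (fun z => shift z.1 z.2 : borel B).

End stationary_noise_process.

(* C([0, T], X) carries the sup metric, i.e. the topology it inherits from the
   space {uniform` `[0, T] -> X} of uniform convergence on [0, T]. *)
Record continuous_sds (R : realType) (B X : polishType R) (shift : R -> B -> B)
    (phi : R -> X -> B -> X) : Prop := {
  sds_path_continuous : forall T : R, 0 < T -> forall x w,
    {within `[0, T], continuous (fun t : R => phi t x (shift (T - t) w))} ;
  sds_continuous : forall T : R, 0 < T ->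
    continuous (fun xw : X * B =>
      (fun t : R => phi t xw.1 (shift (T - t) xw.2))
        : {uniform` `[0, T]%classic -> X}) ;
  sds0 : forall x w, phi 0 x w = x ;
  sdsD : forall t s : R, 0 <= t -> 0 <= s -> forall x w,
    phi (t + s) x w = phi s (phi t x (shift s w)) w
}.

Record metric_dynamical_system (R : realType) d (Om : measurableType d)
    (Pr : probability Om R) (theta : R -> Om -> Om) : Prop := {
  mds_measurable : measurable_fun [set: Om * R] (fun z => theta z.2 z.1) ;
  mds0 : forall w, theta 0 w = w ;
  mdsD : forall s t : R, theta (s + t) = theta s \o theta t ;
  mds_preserving : forall t : R, measure_preserving Pr (theta t)
}.

Record continuous_cocycle (R : realType) d (Om : measurableType d)
    (X : polishType R) (theta : R -> Om -> Om) (Phi : R -> X -> Om -> X)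
    : Prop := {
  cocycle_measurable :
    measurable_fun [set z : R * borel X * Om | 0 <= z.1.1]
      (fun z => Phi z.1.1 z.1.2 z.2 : borel X) ;
  cocycle0 : forall x w, Phi 0 x w = x ;
  cocycleD : forall t s : R, 0 <= t -> 0 <= s -> forall x w,
    Phi (t + s) x w = Phi s (Phi t x w) (theta t w) ;
  cocycle_continuous : forall w,
    {within [set tx : R * X | 0 <= tx.1],
      continuous (fun tx : R * X => Phi tx.1 tx.2 w)}
}.

Definition continuous_rds (R : realType) d (Om : measurableType d)
    (X : polishType R) (Pr : probability Om R) (theta : R -> Om -> Om)
    (Phi : R -> X -> Om -> X) : Prop :=
  metric_dynamical_system Pr theta /\ continuous_cocycle theta Phi.

Definition two_sided_shift (R : realType) (B : polishType R)
    (P : R -> B -> B -> B) (shift : R -> B -> B) (t : R)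
    (w : borel B * borel B) : borel B * borel B :=
  if 0 <= t then (P t w.1 w.2, shift t w.2)
  else (shift (- t) w.1, P (- t) w.2 w.1).

Definition sds_cocycle (R : realType) (B X : polishType R)
    (P : R -> B -> B -> B) (phi : R -> X -> B -> X)
    (t : R) (x : X) (w : borel B * borel B) : X :=
  phi t x (P t w.1 w.2).

(* Main.v *)
(* For 0 <= t <= T the axioms of the noise give
     P_t(w-, w+) = shift_(T-t) (P_T(w-, w+)).
   Hence on [0, T] the cocycle Phi is the jointly continuous pullback flow of the
   SDS evaluated at the fixed measurable variable P_T(w-, w+), which yields both
   its joint measurability (Borel sigma-algebras of second countable spaces
   multiply) and its continuity in (t, x). The same identity deduces the joint
   measurability of P, hence of theta, from that of shift. Invariance of the
   product measure is checked on rectangles for t >= 0, by independence and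
   invariance of PP, and transferred to t < 0 since theta_t inverts theta_(-t).
*)
Require Import Defs.
From HB Require Import structures.
From mathcomp Require Import all_boot all_order all_algebra.
From mathcomp Require Import all_classical all_reals all_analysis.
From mathcomp Require Import measurable_realfun.
From mathcomp Require Import unstable lra.

Set Implicit Arguments.
Unset Strict Implicit.
Unset Printing Implicit Defensive.

Import Order.TTheory GRing.Theory Num.Theory.
Import numFieldNormedType.Exports.

Local Open Scope classical_set_scope.
Local Open Scope ring_scope.

(** * Second countability and Borel measurability of pairs *)

Lemma countable_bigcup_measurable d (T : sigmaRingType d) (U : Type)
    (I : set U) (F : U -> set T) :
  countable I -> (forall i, I i -> measurable (F i)) ->
  measurable (\bigcup_(i in I) F i).
Proof.
move=> /pfcard_geP[->|[f]] mF; first by rewrite bigcup_set0.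
rewrite (reindex_bigcup f setT); [|exact: funS|exact: 'surj_f].
by apply: bigcup_measurable => n _; apply: mF; exact: funS.
Qed.

(** The base consists of balls of radius [1/(n+1)] around points of [D]; interiors are taken because
    a pseudometric ball need not be open. If [r < e/2] and [y] is within [r/2] of [x], the [r]-ball
    at [y] contains a neighbourhood of [x] and stays inside the [e]-ball at [x]. *)
Lemma separable_second_countable (R : realType) (T : pseudoMetricType R)
    (D : set T) : countable D -> dense D -> @second_countable T.
Proof.
move=> cD dD.
pose f (xn : T * nat) : set T := (ball xn.1 (xn.2.+1%:R^-1 : R))°.
exists (f @` (D `*` setT)).
  by apply: card_le_trans (card_image_le _ _) _; exact: countableX.
split=> [_ [xn _ <-]|x V /nbhs_ballP[e /= e0 xeV]]; first exact: open_interior.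
have [n] := @ltr_add_invr R 0 (e / 2) (divr_gt0 e0 (ltr0Sn R 1)).
rewrite add0r; set r : R := n.+1%:R^-1 => re.
have r0 : 0 < r by rewrite invr_gt0.
have [||y [xry Dy]] := dD (ball x (r / 2))°.
- by exists x; apply: nbhsx_ballx; exact: divr_gt0.
- exact: open_interior.
have {}xry := interior_subset xry.
exists (f (y, n)).
  split; first by exists (y, n).
  apply/nbhs_ballP; exists (r / 2) => /=; first exact: divr_gt0.
  by move=> z xrz; apply: ball_splitr xrz; exact: xry.
apply: subset_trans xeV => z /interior_subset yrz.
apply: (ball_splitr (z := y)); last first.
  by apply: le_ball yrz; exact: ltW.
apply: (le_ball (e1 := r / 2)); last exact/ball_sym.
by lra.
Qed.

Lemma polish_second_countable (R : realType) (T : polishType R) :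
  @second_countable T.
Proof.
have [D cD dD] := @separable_subproof R T.
exact: separable_second_countable dD.
Qed.

Lemma real_second_countable (R : realType) : @second_countable R.
Proof.
apply: (@separable_second_countable R R) (@dense_rat R).
by apply: card_le_trans (card_image_le _ _) _; exact: countableP.
Qed.

(* The library endows [S * T] with pointed and topological structures under
   different hypotheses on [S] and [T], hence without their join. *)
HB.instance Definition _ (S T : ptopologicalType) := Pointed.on (S * T)%type.

Lemma open_setX (S T : topologicalType) (U : set S) (V : set T) :
  open U -> open V -> open (U `*` V).
Proof.
rewrite !openE => oU oV [x y] [/= Ux Vy].
by exists (U, V) => //=; split; [exact: oU|exact: oV].
Qed.

Lemma prod_second_countable (S T : topologicalType) :
  @second_countable S -> @second_countable T -> @second_countable (S * T)%type.
Proof.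
move=> [BS cBS [oBS bBS]] [BT cBT [oBT bBT]].
pose f (UV : set S * set T) : set (S * T) := UV.1 `*` UV.2.
exists (f @` (BS `*` BT)).
  by apply: card_le_trans (card_image_le _ _) _; exact: countableX.
split=> [_ [UV [/oBS ? /oBT ?] <-]|[x y] W]; first exact: open_setX.
move=> [[U V] /= [/bBS[U' [BU' U'x] U'U] /bBT[V' [BV' V'y] V'V]] UVW].
exists (f (U', V')); first by split => //; exists (U', V').
by move=> [u v] [/U'U ? /V'V ?]; exact: UVW.
Qed.

Lemma continuous_borel_measurable (S T : ptopologicalType) (f : S -> T) :
  continuous f -> measurable_fun setT (f : borel S -> borel T).
Proof.
move=> /continuousP cf.
apply: (@measurability _ _ (borel S) (borel T) _ _ (@open T)) => // _ [U oU <-].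
by rewrite setTI; apply: sub_sigma_algebra; exact: cf.
Qed.

Lemma measurable_real_borel (R : realType) :
  measurable_fun setT (idfun : R -> borel R).
Proof.
apply: (@measurability _ _ R (borel R) _ _ (@open R)) => // _ [U oU <-].
by rewrite setTI; exact: open_measurable.
Qed.

(** An open set of the product is a countable union of basic rectangles, so its preimage is a
    countable union of measurable sets. *)
Lemma measurable_pair_borel d (Om : measurableType d) (S T : ptopologicalType)
    (D : set Om) (f : Om -> S) (g : Om -> T) :
  @second_countable S -> @second_countable T ->
  measurable_fun D (f : Om -> borel S) ->
  measurable_fun D (g : Om -> borel T) ->
  measurable_fun D ((fun z => (f z, g z)) : Om -> borel (S * T)%type).
Proof.
move=> [BS cBS [oBS bBS]] [BT cBT [oBT bBT]] mf mg mD.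
move: (mD).
apply: (@measurability _ _ Om (borel (S * T)%type) _ _
  (@open (S * T)%type)) => // _ [W oW <-].
pose I := [set UV | (BS `*` BT) UV /\ UV.1 `*` UV.2 `<=` W].
rewrite [X in measurable X](_ : _ =
    \bigcup_(UV in I) ((D `&` f @^-1` UV.1) `&` (D `&` g @^-1` UV.2))).
  apply: countable_bigcup_measurable => [|[U V] [[/= BU BV] _]].
    apply: sub_countable (countableX cBS cBT); apply: subset_card_le.
    by move=> ? [].
  apply: measurableI.
    by apply: mf => //; apply: sub_sigma_algebra; exact: (oBS _ BU).
  by apply: mg => //; apply: sub_sigma_algebra; exact: (oBT _ BV).
rewrite eqEsubset; split=> z; last first.
  by case=> -[U V] [_ UVW] [[Dz Uz] [_ Vz]]; split=> //; exact: UVW.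
case=> Dz Wz.
have [[U V] /= [/bBS[U' [BU' U'x] U'U] /bBT[V' [BV' V'y] V'V]] UVW] :=
  open_nbhs_nbhs (conj oW Wz : open_nbhs (f z, g z) W).
exists (U', V') => //; split=> // -[u v] [/= /U'U ? /V'V ?]; exact: UVW.
Qed.

(** * Nonnegative times as a countable union of slabs *)

Lemma ge0_fst_bigcup (R : realType) (T : Type) :
  [set z : R * T | 0 <= z.1] = \bigcup_n [set z : R * T | 0 <= z.1 <= n%:R].
Proof.
apply/seteqP; split=> [z /= z0|z [n _] /= /andP[]//].
by exists (Num.truncn z.1).+1 => //=; rewrite z0 ltW// truncnS_gt.
Qed.

Lemma measurable_fst_itv (R : realType) d (T : measurableType d) (a b : R) :
  measurable [set z : R * T | a <= z.1 <= b].
Proof.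
rewrite -[X in measurable X]setTI (_ : [set z | _] = fst @^-1` `[a, b]%classic).
  by apply: measurable_fst => //; exact: measurable_itv.
by apply/seteqP; split=> z /=; rewrite in_itv.
Qed.

Lemma measurable_fst_ge0 (R : realType) d (T : measurableType d) :
  measurable [set z : R * T | 0 <= z.1].
Proof.
by rewrite ge0_fst_bigcup; apply: bigcup_measurable => n _;
  exact: measurable_fst_itv.
Qed.

Lemma measurable_fun_nonneg_time (R : realType) d1 d2 d3
    (Om : measurableType d1) (T : measurableType d2) (U : measurableType d3)
    (D : set Om) (f : R * T -> U) (u : Om -> R) (v : Om -> T) :
  measurable_fun [set z : R * T | 0 <= z.1] f ->
  measurable_fun setT u -> measurable_fun setT v ->
  (forall z, D z -> 0 <= u z) ->
  measurable_fun D (fun z => f (u z, v z)).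
Proof.
move=> mf mu mv u0; apply: (measurable_comp (@measurable_fst_ge0 R _ T) _ mf).
  by move=> _ [z /u0 uz0 <-].
by apply: measurable_funTS; exact: measurable_fun_pair.
Qed.

(** * Group law of the two-sided shift *)

Section noise_dynamics.
Context (R : realType) (B : polishType R).
Variables (P : R -> B -> B -> B) (PP : probability (borel B) R).
Variable shift : R -> B -> B.
Hypothesis noise : stationary_noise_process P PP shift.

Local Notation theta := (two_sided_shift P shift).

(** [shift 0] is idempotent, and surjective by [shift_noiseK] at time 0, hence the identity. *)
Lemma shift0 w : shift 0 w = w.
Proof.
have K := shift_noiseK noise (lexx 0).
have := shiftD noise (lexx 0) (lexx 0).
rewrite addr0 => /(congr1 (@^~ (P 0 w w))).
by rewrite /= K.
Qed.

Lemma noise0 w1 w2 : P 0 w1 w2 = w1.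
Proof. by rewrite -[LHS]shift0 (shift_noiseK noise). Qed.

(** Splitting [T = (T - t) + t] by [noiseD] exhibits [P T] as [P (T - t)] applied to [P t w1 w2],
    and the shift cancels this outer step. *)
Lemma shift_noise t T w1 w2 : 0 <= t <= T ->
  shift (T - t) (P T w1 w2) = P t w1 w2.
Proof.
move=> /andP[t0 tT]; rewrite -[T in P T](subrK t).
by rewrite (noiseD noise) ?subr_ge0// (shift_noiseK noise) ?subr_ge0.
Qed.

Lemma two_sided_shift_ge0 t w : 0 <= t ->
  theta t w = (P t w.1 w.2, shift t w.2).
Proof. by rewrite /two_sided_shift => ->. Qed.

Lemma two_sided_shift0 w : theta 0 w = w.
Proof. by rewrite two_sided_shift_ge0// noise0 shift0; case: w. Qed.

(** Time reversal exchanges past and future. Conjugation by [swap] serves below to reduce negative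
    times to nonnegative ones. *)
Lemma two_sided_shiftN t w : theta (- t) w = swap (theta t (swap w)).
Proof.
wlog t0 : t w / 0 <= t.
  move=> h; have [|/ltW t0] := leP 0 t; first exact: h.
  have /h E : 0 <= - t by rewrite oppr_ge0.
  by have := E (swap w); rewrite opprK swapK => ->; rewrite swapK.
(* At time 0 both sides fall in the nonnegative branch of the definition, so this case is
   separate. *)
have [->|t_neq0] := eqVneq t 0; first by rewrite oppr0 !two_sided_shift0 swapK.
rewrite /two_sided_shift t0 oppr_ge0 leNgt lt_neqAle eq_sym t_neq0 t0/=.
by rewrite opprK.
Qed.

Lemma two_sided_shiftD_ge0 t s w : 0 <= t -> 0 <= s ->
  theta (t + s) w = theta t (theta s w).
Proof.
move=> t0 s0; rewrite !two_sided_shift_ge0 ?addr_ge0//=.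
by rewrite (noiseD noise)// (shiftD noise).
Qed.

Lemma two_sided_shiftNK t w : theta (- t) (theta t w) = w.
Proof.
wlog t0 : t w / 0 <= t.
  move=> h; have [|/ltW t0] := leP 0 t; first exact: h.
  have /h E : 0 <= - t by rewrite oppr_ge0.
  have -> : theta t w = swap (theta (- t) (swap w)).
    by rewrite -two_sided_shiftN opprK.
  by rewrite two_sided_shiftN swapK; have := E (swap w); rewrite opprK => ->;
    rewrite swapK.
rewrite two_sided_shiftN !two_sided_shift_ge0//= (noise_shiftK noise)//.
by rewrite (shift_noiseK noise)//; case: w.
Qed.

Lemma two_sided_shiftK t w : theta t (theta (- t) w) = w.
Proof. by have := two_sided_shiftNK (- t) w; rewrite opprK. Qed.

Lemma two_sided_shiftD t s : theta (t + s) = theta t \o theta s.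
Proof.
apply/funext => w /=; wlog t0 : t s w / 0 <= t.
  move=> h; have [|/ltW t0] := leP 0 t; first exact: h.
  have /h E : 0 <= - t by rewrite oppr_ge0.
  (* Conjugating by [swap] flips the signs of both [t] and [s]. *)
  have := E (- s) (swap w); rewrite -opprD !two_sided_shiftN !swapK.
  by move=> /(congr1 swap); rewrite !swapK.
have [s0|/ltW s0] := leP 0 s; first exact: two_sided_shiftD_ge0.
(* If [t + s >= 0], write [w] as [theta (- s) (theta s w)] and add the nonnegative times [t + s] and
   [- s]. Otherwise, after reversal, [- s] is the sum of the nonnegative times [t] and
   [- (t + s)]. *)
have [ts0|/ltW ts0] := leP 0 (t + s).
  rewrite -[w in LHS](two_sided_shiftNK s) -two_sided_shiftD_ge0 ?oppr_ge0//.
  by rewrite addrK.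
have E : theta s w = theta (- t) (theta (t + s) w).
  have -> : theta s = theta (- (t - (t + s))).
    by rewrite opprB addrAC subrr add0r.
  have -> : theta (t + s) w = swap (theta (- (t + s)) (swap w)).
    by rewrite -two_sided_shiftN opprK.
  rewrite [LHS]two_sided_shiftN [RHS]two_sided_shiftN swapK.
  by rewrite two_sided_shiftD_ge0 ?oppr_ge0.
by rewrite E two_sided_shiftK.
Qed.

(** * Measurability and invariance of the two-sided shift *)

Lemma measurable_two_sided_shift t : measurable_fun setT (theta t).
Proof.
have h s : 0 <= s -> measurable_fun setT (theta s).
  move=> s0.
  have -> : theta s = fun w => (P s w.1 w.2, shift s w.2).
    by apply/funext => w; rewrite two_sided_shift_ge0.
  apply: measurable_fun_pair; first exact: (noise_measurable noise).
  by apply: measurableT_comp measurable_snd; exact: (shift_measurable noise).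
have [|/ltW t0] := leP 0 t; first exact: h.
rewrite (_ : theta t = swap \o theta (- t) \o swap); last first.
  by apply/funext => w /=; rewrite -two_sided_shiftN opprK.
apply: measurableT_comp; last exact: measurable_swap.
apply: measurableT_comp; first exact: measurable_swap.
by apply: h; rewrite oppr_ge0.
Qed.

Lemma two_sided_shift_preserving t : measure_preserving (PP \x PP)%E (theta t).
Proof.
have mth s := measurable_two_sided_shift s.
split=> //; wlog t0 : t / 0 <= t.
  move=> h; have [|/ltW t0] := leP 0 t; first exact: h.
  move=> A mA; rewrite /pushforward -[LHS](h (- t)) ?oppr_ge0//.
    rewrite /pushforward -comp_preimage; congr (product_measure1 _ _ _).
    by apply/seteqP; split=> w /=; rewrite two_sided_shiftK.
  by rewrite -[X in measurable X]setTI; exact: mth.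
move=> A mA; apply/esym.
pose m' := measure_function_pushforward__canonical__measure_function_Measure
  (PP \x PP)%E (mth t).
apply: (@product_measure_unique _ _ _ _ _ PP PP m') => // {mA}A C mA mC.
rewrite /m' /= /pushforward /product_measure1.
(* For a fixed past [w], independence factors the measure of the section, and preservation by
   [shift t] makes the second factor [PP C]. Invariance of [PP] then evaluates the integral of the
   kernel to [PP A]. *)
transitivity (\int[PP]_w (noise_kernel P PP t w A * PP C))%E.
  apply: eq_integral => w _ /=.
  have [_ /(_ _ mC) <-] := shift_preserving noise t0.
  rewrite -(noise_shift_independent noise t0 w mA mC).
  congr (PP _); apply/seteqP.
  by split=> w2; rewrite /xsection /= inE /= two_sided_shift_ge0.
rewrite ge0_integralZr//; first by rewrite (noise_invariant noise).
  exact: (kernel_measurable (noise_feller noise)).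
by move=> w _; rewrite /noise_kernel /pushforward.
Qed.

Lemma measurable_joint_noise : jointly_measurable_shift shift ->
  measurable_fun [set z : R * (borel B * borel B) | 0 <= z.1]
    (fun z => P z.1 z.2.1 z.2.2 : borel B).
Proof.
move=> mshift; rewrite ge0_fst_bigcup.
apply/measurable_fun_bigcup => [n|n]; first exact: measurable_fst_itv.
(* On the slab of times up to [n], the noise is [shift (n - t)] applied to [P n]; the horizon being
   fixed, [P n] is measurable by assumption. *)
pose g (z : R * (borel B * borel B)) : R * borel B :=
  (n%:R - z.1, P n%:R z.2.1 z.2.2).
apply: (eq_measurable_fun ((fun z => shift z.1 z.2 : borel B) \o g)).
  by move=> z; rewrite inE /= => /shift_noise ->.
apply: (measurable_fun_nonneg_time mshift) => [||z /andP[_]]; last first.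
- by rewrite /= subr_ge0.
- have mPn := noise_measurable noise (ler0n R n).
  exact: measurableT_comp mPn measurable_snd.
- by apply: measurable_funB => //; exact: measurable_fst.
Qed.

Lemma measurable_joint_two_sided_shift : jointly_measurable_shift shift ->
  measurable_fun setT
    (fun z : (borel B * borel B) * R => theta z.2 z.1).
Proof.
move=> mshift; have mP := measurable_joint_noise mshift.
rewrite /jointly_measurable_shift in mshift.
have mle : measurable_fun setT
    (fun z : (borel B * borel B) * R => 0 <= z.2).
  by apply: measurable_fun_ler => //; exact: measurable_snd.
have m11 : measurable_fun setT (fun z : (borel B * borel B) * R => z.1.1).
  exact: measurableT_comp measurable_fst measurable_fst.
have m12 : measurable_fun setT (fun z : (borel B * borel B) * R => z.1.2).
  exact: measurableT_comp measurable_snd measurable_fst.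
have mN : measurable_fun setT (fun z : (borel B * borel B) * R => - z.2).
  by apply: measurableT_comp; [exact: oppr_measurable|exact: measurable_snd].
apply/measurable_fun_pairP; split.
- rewrite (_ : _ \o _ = fun z : (borel B * borel B) * R => if 0 <= z.2
      then P z.2 z.1.1 z.1.2 : borel B else shift (- z.2) z.1.1); last first.
    by apply/funext => z /=; rewrite /two_sided_shift; case: ifP.
  apply: measurable_fun_if => //.
  + apply: (measurable_fun_nonneg_time mP _ measurable_fst) => [|z []//].
    exact: measurable_snd.
  + apply: (measurable_fun_nonneg_time mshift mN m11) => z [_ /= z0].
    by rewrite oppr_ge0 ltW// ltNge z0.
- rewrite (_ : _ \o _ = fun z : (borel B * borel B) * R => if 0 <= z.2
      then shift z.2 z.1.2 : borel B else P (- z.2) z.1.2 z.1.1); last first.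
    by apply/funext => z /=; rewrite /two_sided_shift; case: ifP.
  apply: measurable_fun_if => //.
  + apply: (measurable_fun_nonneg_time mshift _ m12) => [|z []//].
    exact: measurable_snd.
  + apply: (measurable_fun_nonneg_time (v := fun z => (z.1.2, z.1.1)) mP mN).
      exact: measurable_fun_pair.
    by move=> z [_ /= z0]; rewrite oppr_ge0 ltW// ltNge z0.
Qed.

End noise_dynamics.

(** * The pullback flow and the cocycle it represents *)

Definition clamp (R : realType) (T t : R) : R := Num.max 0 (Num.min t T).

Lemma clamp_itv (R : realType) (T t : R) : 0 <= T -> 0 <= clamp T t <= T.
Proof. by move=> T0; rewrite /clamp le_max lexx ge_max T0 ge_min lexx orbT. Qed.

Lemma clamp_id (R : realType) (T t : R) : 0 <= t <= T -> clamp T t = t.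
Proof. by move=> /andP[t0 tT]; rewrite /clamp (min_l tT) (max_r t0). Qed.

Lemma clamp_continuous (R : realType) (T : R) : continuous (@clamp R T).
Proof.
move=> t; apply: (@continuous_max R R (cst 0) (fun s => Num.min s T)).
  exact: cst_continuous.
by apply: (@continuous_min R R id (cst T)) => //; exact: cst_continuous.
Qed.

Section cocycle.
Context (R : realType) (B X : polishType R).
Variables (P : R -> B -> B -> B) (PP : probability (borel B) R).
Variables (shift : R -> B -> B) (phi : R -> X -> B -> X).
Hypotheses (noise : stationary_noise_process P PP shift)
  (sds : continuous_sds shift phi).

Local Notation theta := (two_sided_shift P shift).
Local Notation Phi := (sds_cocycle P phi).

(* Clamping time makes the pullback flow [varphi~_T] of the SDS total, hence
   jointly continuous on a genuine product space. *)
Definition pullback_flow (T : R) (z : R * (X * B)) : X :=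
  phi (clamp T z.1) z.2.1 (shift (T - clamp T z.1) z.2.2).

(** Two half-entourages are chained through the point [G xw0 (clamp T t)]: the first moves time
    along the single path of [xw0], the second moves [xw] uniformly in time. *)
Lemma pullback_flow_continuous T : 0 < T -> continuous (pullback_flow T).
Proof.
move=> T0 [t0 xw0]; apply/cvg_entourageP => E entE.
pose G (xw : X * B) : {uniform` `[0, T]%classic -> X} :=
  fun t => phi t xw.1 (shift (T - t) xw.2).
have cT t : `[0, T]%classic (clamp T t) by rewrite /= in_itv/= clamp_itv// ltW.
have Gt : \forall t \near t0,
    split_ent E (G xw0 (clamp T t0), G xw0 (clamp T t)).
  have /subspace_continuousP/(_ _ (cT t0))/cvg_entourageP :=
    @sds_path_continuous _ _ _ _ _ sds T T0 xw0.1 xw0.2.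
  move=> /(_ _ (entourage_split_ent entE)).
  move=> /(@clamp_continuous R T t0) h.
  by apply: (@filterS _ (nbhs t0) _ _ _ _ h) => t Et; exact: Et (cT t).
have Gxw : \forall xw \near xw0,
    forall t, `[0, T]%classic t -> split_ent E (G xw0 t, G xw t).
  apply: (@sds_continuous _ _ _ _ _ sds T T0 xw0
    [set g | forall t, `[0, T]%classic t -> split_ent E (G xw0 t, g t)]).
  apply/uniform_nbhs.
  by exists (split_ent E); split=> //; exact: entourage_split_ent.
exists ([set t | split_ent E (G xw0 (clamp T t0), G xw0 (clamp T t))],
  [set xw | forall t, `[0, T]%classic t -> split_ent E (G xw0 t, G xw t)])
  => //.
move=> [t xw] [/= Et Exw].
by apply: (entourage_split (G xw0 (clamp T t)) entE Et); exact: Exw _ (cT t).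
Qed.

Lemma sds_cocycleE T t x w : 0 <= t <= T ->
  Phi t x w = pullback_flow T (t, (x, P T w.1 w.2)).
Proof.
by move=> tT; rewrite /pullback_flow /= clamp_id// (shift_noise noise).
Qed.

Lemma measurable_sds_cocycle :
  measurable_fun [set z : R * borel X * (borel B * borel B) | 0 <= z.1.1]
    (fun z => Phi z.1.1 z.1.2 z.2 : borel X).
Proof.
have -> : [set z : R * borel X * (borel B * borel B) | 0 <= z.1.1] =
    \bigcup_n [set z | 0 <= z.1.1 <= n.+1%:R].
  apply/seteqP; split=> [z /= z0|z [n _] /= /andP[]//].
  (* Slabs end at [n + 1], not [n], so that every horizon is positive, as continuity of the pullback
     flow requires. *)
  by exists (Num.truncn z.1.1) => //=; rewrite z0 ltW// truncnS_gt.
have m11 : measurable_fun setT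
    (fun z : R * borel X * (borel B * borel B) => z.1.1).
  exact: measurableT_comp measurable_fst measurable_fst.
have m12 : measurable_fun setT
    (fun z : R * borel X * (borel B * borel B) => z.1.2).
  exact: measurableT_comp measurable_snd measurable_fst.
apply/measurable_fun_bigcup => n.
  rewrite -[X in measurable X]setTI.
  rewrite (_ : [set z | _] = (fun z => z.1.1) @^-1` `[0, n.+1%:R]%classic).
    by apply: m11 => //; exact: measurable_itv.
  by apply/seteqP; split=> z /=; rewrite in_itv.
(* The target carries the Borel sigma-algebra of the topological product, where continuity of the
   flow gives measurability; [measurable_pair_borel] then handles [g]. *)
pose g (z : R * borel X * (borel B * borel B)) : borel (R * (X * B))%type :=
  (z.1.1, (z.1.2, P n.+1%:R z.2.1 z.2.2)).
apply: (eq_measurable_fun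
  ((pullback_flow n.+1%:R : borel (R * (X * B))%type -> borel X) \o g)).
  by move=> z; rewrite inE /= => zn; rewrite (sds_cocycleE _ _ zn).
apply: measurableT_comp.
  have cF := pullback_flow_continuous (ltr0Sn R n).
  exact: (@continuous_borel_measurable _ _ _ cF).
apply: measurable_funTS; apply: measurable_pair_borel.
- exact: real_second_countable.
- by apply: prod_second_countable; exact: polish_second_countable.
- exact: measurableT_comp (@measurable_real_borel R) m11.
apply: measurable_pair_borel.
- exact: polish_second_countable.
- exact: polish_second_countable.
- exact: m12.
have mPn := noise_measurable noise (ler0n R n.+1).
exact: measurableT_comp mPn measurable_snd.
Qed.

Lemma sds_cocycle_continuous w : {within [set tx : R * X | 0 <= tx.1],
  continuous (fun tx : R * X => Phi tx.1 tx.2 w)}.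
Proof.
apply/subspace_continuousP => -[t x] /= t0.
(* A horizon strictly beyond [t] keeps all times near [t] below [T], so [Phi] and [f] agree near
   [(t, x)] at nonnegative times. *)
pose T := t + 1.
have T0 : 0 < T by rewrite ltr_wpDl.
pose f (z : R * X) := pullback_flow T (z.1, (z.2, P T w.1 w.2)).
have Etx : Phi t x w = f (t, x) by apply: sds_cocycleE; rewrite t0 lerDl ler01.
have cf : f z @[z --> (t, x)] --> Phi t x w.
  rewrite Etx.
  have cg : (z.1, (z.2, P T w.1 w.2)) @[z --> (t, x)]
      --> (t, (x, P T w.1 w.2)).
    apply: (@cvg_pair _ _ _ _ (nbhs t) (nbhs (x, P T w.1 w.2))).
      exact: (@cvg_fst _ _ (nbhs t) (nbhs x)).
    apply: (@cvg_pair _ _ _ _ (nbhs x) (nbhs (P T w.1 w.2))).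
      exact: (@cvg_snd _ _ (nbhs t) (nbhs x)).
    exact: cvg_cst.
  apply: cvg_comp cg _; exact: (pullback_flow_continuous T0).
apply: cvg_trans (cvg_within_filter _ cf).
apply: near_eq_cvg; rewrite near_withinE.
have : \forall z \near (t, x), z.1 < T.
  exists ([set s | s < T], setT) => [|z []//].
  by split; [apply: lt_nbhsl; rewrite ltrDl|exact: filterT].
by apply: filterS => z /ltW zT z0; apply/esym/sds_cocycleE; rewrite z0.
Qed.

(** The noise [P (t + s)] of [w] equals [P s] of [theta t w], and [shift s] sends it back to [P t]
    of [w]; the composition rule [sdsD] at this noise is then the cocycle identity. *)
Lemma sds_cocycleD t s x w : 0 <= t -> 0 <= s ->
  Phi (t + s) x w = Phi s (Phi t x w) (theta t w).
Proof.
move=> t0 s0; rewrite /sds_cocycle (sdsD sds)//.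
have -> : P (t + s) w.1 w.2 = P s (theta t w).1 (theta t w).2.
  by rewrite two_sided_shift_ge0//= addrC (noiseD noise).
by rewrite two_sided_shift_ge0//= (shift_noiseK noise).
Qed.

Lemma sds_continuous_cocycle : continuous_cocycle theta Phi.
Proof.
split.
- exact: measurable_sds_cocycle.
- by move=> x w; rewrite /sds_cocycle (sds0 sds).
- by move=> t s t0 s0 x w; exact: sds_cocycleD.
- exact: sds_cocycle_continuous.
Qed.

End cocycle.

Theorem theorem3p2 (R : realType) (B X : polishType R)
    (P : R -> B -> B -> B) (PP : probability (borel B) R)
    (shift : R -> B -> B) (phi : R -> X -> B -> X) :
  stationary_noise_process P PP shift ->
  continuous_sds shift phi ->
  let theta := two_sided_shift P shift in
  let Phi := sds_cocycle P phi in
  [/\ forall t s : R, theta (t + s) = theta t \o theta s,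
      forall t : R, measure_preserving (PP \x PP)%E (theta t),
      continuous_cocycle theta Phi,
      jointly_measurable_shift shift ->
        continuous_rds (PP \x PP)%E theta Phi
    & forall t s : R, 0 <= t -> 0 <= s -> forall x w,
        Phi (t + s) x w = Phi s (Phi t x w) (theta t w)].
Proof.
move=> noise sds theta Phi.
have thetaD := two_sided_shiftD noise.
have theta_pres := two_sided_shift_preserving noise.
have coc := sds_continuous_cocycle noise sds.
split=> // [mshift|t s t0 s0 x w]; last exact: (sds_cocycleD noise sds).
split=> //; split=> //.
(* Joint measurability of [theta] in noise and time comes from that of [shift]. *)
- exact: (measurable_joint_two_sided_shift noise).
- exact: (two_sided_shift0 noise).
Qed.
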